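(* Let $\mathbb{K}$ be an arbitrary field and let $n$ be a non-negative integer. Let $N$ be a rank $n-1$ matrix of $\mathrm{M}_n(\mathbb{K})$. Let $\mathcal{S}$ be an affine subspace of $\mathrm{M}_n(\mathbb{K})$ such that $\operatorname{codim} \mathcal{S} \leq n-2$. Assume that at least one matrix of $\mathcal{S}$ maps $\operatorname{Ker} N$ into $\operatorname{Im} N$. Then there exists $A \in \mathcal{S}$ such that every matrix of $A + \mathbb{K} N$ is invertible.
   Context: $\mathrm{M}_n(\mathbb{K})$ denotes the $\mathbb{K}$-vector space of all $n$ by $n$ matrices with entries in $\mathbb{K}$; matrices act on column vectors in $\mathbb{K}^n$, and $\operatorname{Ker} N$, $\operatorname{Im} N \subseteq \mathbb{K}^n$ are the kernel and the column space of $N$. An affine subspace is a translate of a linear subspace (its translation vector space), and its codimension in $\mathrm{M}_n(\mathbb{K})$ is $n^2$ minus the dimension of its translation vector space. $A + \mathbb{K}N := \{A + \lambda N : \lambda \in \mathbb{K}\}$. *)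

(* Defs.v *)
From mathcomp Require Import all_boot all_order all_algebra.
Set Implicit Arguments.
Unset Strict Implicit.
Unset Printing Implicit Defensive.
Import GRing.Theory.
Local Open Scope ring_scope.

(* The affine subspace [base_point + direction]; two values with the same
   direction whose base points differ by an element of it have the same
   points, so only membership and [codim] are meaningful. *)
Record affine_subspace (K : fieldType) (vT : vectType K) := AffineSubspace {
  base_point : vT;
  direction : {vspace vT}
}.

Definition affine_mem (K : fieldType) (vT : vectType K)
    (S : affine_subspace vT) : pred vT :=
  fun x => x - base_point S \in direction S.

Canonical affine_predType (K : fieldType) (vT : vectType K) :=
  PredType (@affine_mem K vT).

(* The truncated subtraction is exact, as [\dim (direction S) <= n ^ 2]. *)
Definition codim (K : fieldType) (n : nat)
    (S : affine_subspace 'M[K]_n) : nat :=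
  (n ^ 2 - \dim (direction S))%N.

(* Matrices act on column vectors, unlike in [mxalgebra], where [kermx] and
   row spaces refer to the action on row vectors. *)
Definition in_Ker (K : fieldType) (n : nat) (N : 'M[K]_n) (x : 'cV[K]_n) :
  Prop := N *m x = 0.

Definition in_Im (K : fieldType) (n : nat) (N : 'M[K]_n) (y : 'cV[K]_n) :
  Prop := exists x : 'cV[K]_n, y = N *m x.

(* Main.v *)
From HB Require Import structures.
From Stdlib Require Import Classical.
Require Import Defs.
From mathcomp Require Import all_boot all_order all_algebra zify.
Set Implicit Arguments.
Unset Strict Implicit.
Unset Printing Implicit Defensive.
Import GRing.Theory.
Local Open Scope ring_scope.

(** Flags drive the proof. If [Ker N] is the line of [x1] and vectors
    [x2, ..., xn] complete [x1] to a basis, then every matrix [A] such that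
    [A x_i] is [N x_(i+1)] modulo the span of the earlier [N x_j], and [A x_n]
    lies outside [Im N], makes the whole pencil [A + l N] triangular with a
    constant nonzero diagonal. The task is to find such a flag adapted to the
    affine space [S = M + V].

    The flag is built one step at a time, by induction on [n]. Once
    [A x1 = N x2 <> 0] holds for some [A] in [S], the source can be divided by
    the line of [x1] and the target by the line of [N x2]. In size [n - 1], [N]
    again has nullity one, with kernel the line of [x2], and invertibility of
    the smaller pencil gives that of the larger one ([pencil_of_deflate]). To
    use the induction hypothesis, [A x2] must lie in [Im N], and the
    codimension must drop by at least one ([descent]).

    Let [psi] be a row vector whose kernel is [Im N]. A dimension count
    ([find_second_vector]) always gives an [x2] for which [psi A x2] can be
    adjusted to [0]. By [dim_deflated], the codimension drops unless it had room
    to spare already, [V x1] is a proper subspace, or some product of the column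
    [N x2] by a row killing [x1] is missing from [V]. When none of these escapes
    is available for any admissible [x2], [V] contains every matrix [B] with
    [B x1 = 0] and [psi B = 0]: membership in [S] depends only on the border
    [(A x1, psi A)]. This is the saturated case ([unit_line_saturated]).

    In the saturated case the inside of the matrix is free, so any border
    [(N v, b)] with [b <> 0], [b v = 0] and [N v <> 0] extends to a triangular
    pencil ([flag_completion]). If none were available, the affine
    space of borders would contain [(N v, 0)] for all [v] outside a hyperplane,
    and affine combinations of these would provide one after all. There is one
    exception: [n = 3] over the field with two elements, where a triangular
    pencil may not exist. Then
    [S] contains a matrix [A] for which [det (A + l N)] is, in suitable bases,
    [l ^ 2 + l + 1], which has no root ([exceptional_pencil]). *)

(** * Linear algebra *)

Lemma unitmx_inj (K : fieldType) (n : nat) (A : 'M[K]_n)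
    (injA : forall v : 'cV[K]_n, A *m v = 0 -> v = 0) :
  A \in unitmx.
Proof.
rewrite -unitmx_tr -row_free_unit; apply: inj_row_free => v vA0.
by apply: trmx_inj; rewrite trmx0; apply: injA; rewrite -[A]trmxK -trmx_mul vA0 trmx0.
Qed.

Lemma mx11_neq0 (K : fieldType) (p : 'M[K]_1) : p != 0 -> p 0 0 != 0.
Proof. by apply: contraNneq => p0; rewrite [p]mx11_scalar p0 raddf0. Qed.

Lemma mx11_div (K : fieldType) (p b : 'M[K]_1) :
  p != 0 -> (b 0 0 / p 0 0) *: p = b.
Proof.
move=> p0; rewrite {2}[p]mx11_scalar scale_scalar_mx divfK ?mx11_neq0 //.
by rewrite -mx11_scalar.
Qed.

Lemma mulmx_colP (K : fieldType) m n (A B : 'M[K]_(m, n)) :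
  (forall v : 'cV[K]_n, A *m v = B *m v) -> A = B.
Proof. by move=> AB; apply/trmx_inj/row_matrixP => j; rewrite -!tr_col !colE AB. Qed.

Lemma dim_limg_le (K : fieldType) (aT rT : vectType K) (f : 'Hom(aT, rT)) (U : {vspace aT}) :
  (\dim (f @: U) <= \dim U)%N.
Proof. by rewrite -[X in (_ <= X)%N](limg_ker_dim f U) leq_addl. Qed.

Lemma dim_colf (K : fieldType) n : \dim {:'cV[K]_n} = n.
Proof. by rewrite dimvf /dim /= muln1. Qed.

Lemma dim_rowf (K : fieldType) n : \dim {:'rV[K]_n} = n.
Proof. by rewrite dimvf /dim /= mul1n. Qed.

Lemma dim_sqmxf (K : fieldType) n : \dim {:'M[K]_n} = (n ^ 2)%N.
Proof. by rewrite dimvf /dim /= -mulnn. Qed.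

Lemma dim_le_col (K : fieldType) n (U : {vspace 'cV[K]_n}) : (\dim U <= n)%N.
Proof. by rewrite -[X in (_ <= X)%N](dim_colf K) dimvS ?subvf. Qed.

Lemma dim_vline_le (K : fieldType) (vT : vectType K) (v : vT) : (\dim <[v]>%VS <= 1)%N.
Proof. by rewrite dim_vline; case: (v != 0). Qed.

(** Rank-nullity: the kernel of [D] has dimension at least [n - r], too large
    to fit in [W]. *)
Lemma ker_outside (K : fieldType) r n (D : 'M[K]_(r, n)) (W : {vspace 'cV[K]_n})
    (small : (r + \dim W < n)%N) :
  exists2 z : 'cV[K]_n, D *m z = 0 & z \notin W.
Proof.
pose f : 'Hom('cV[K]_n, 'cV[K]_r) := linfun (mulmx D).
have : ~~ (lker f <= W)%VS.
  apply: contraL small => /dimvS kW; rewrite -leqNgt.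
  have := limg_ker_dim f fullv; rewrite capfv dim_colf => {1}<-.
  by rewrite addnC leq_add ?dim_le_col.
case/subvPn=> z; rewrite memv_ker lfunE /= => /eqP; by exists z.
Qed.

(** Mutually orthogonal spaces of rows and columns correspond, through bases, to
    two matrices with zero product, whose ranks add up to at most [s]. *)
Lemma dim_orthogonal (K : fieldType) s (D : {vspace 'rV[K]_s}) (U : {vspace 'cV[K]_s}) :
  (forall d u, d \in D -> u \in U -> d *m u = 0) -> (\dim D + \dim U <= s)%N.
Proof.
move=> DU.
pose A : 'M[K]_(\dim D, s) := \matrix_i (vbasis D)`_i.
pose B : 'M[K]_(\dim U, s) := \matrix_i ((vbasis U)`_i)^T.
have rA : \rank A = \dim D.
  apply/eqP/inj_row_free => v /eqP; rewrite mulmx_sum_row => /eqP v0.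
  have /freeP fD := basis_free (vbasisP D).
  apply/rowP => i; rewrite mxE; apply: fD.
  by rewrite -[RHS]v0; apply: eq_bigr => j _; rewrite rowK.
have rB : \rank B = \dim U.
  apply/eqP/inj_row_free => v /eqP; rewrite mulmx_sum_row => /eqP v0.
  have /freeP fU := basis_free (vbasisP U).
  apply/rowP => i; rewrite mxE; apply: fU; apply: trmx_inj.
  rewrite trmx0 -[RHS]v0 linear_sum; apply: eq_bigr => j _.
  by rewrite rowK linearZ.
rewrite -rA -rB -(mxrank_tr B); apply: mulmx0_rank_max.
apply/row_matrixP => i; rewrite row_mul rowK row0; apply/mulmx_colP => v.
rewrite mul0mx -mulmxA [B^T *m v](_ : _ = (v^T *m B)^T); last by rewrite trmx_mul trmxK.
rewrite [v^T *m B]mulmx_sum_row linear_sum mulmx_sumr big1 // => j _.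
rewrite rowK linearZ /= trmxK -scalemxAr DU ?scaler0 //.
  by apply: vbasis_mem; rewrite mem_nth ?size_tuple.
by apply: vbasis_mem; rewrite mem_nth ?size_tuple.
Qed.

(** Nullity one with a named generator of the kernel: unlike the condition
    [\rank N = n - 1], this passes to quotients by a direct argument on
    vectors. *)
Definition ker_line (K : fieldType) (n : nat) (N : 'M[K]_n) (x : 'cV[K]_n) :=
  [/\ x != 0, N *m x = 0 & forall v : 'cV[K]_n, N *m v = 0 -> exists c : K, v = c *: x].

(** Both [Im N] and the kernel of [psi] are hyperplanes, and one contains the
    other. *)
Lemma left_kernel (K : fieldType) n (N : 'M[K]_n.+1) (x : 'cV[K]_n.+1) :
  ker_line N x ->
  exists psi : 'rV[K]_n.+1, [/\ psi != 0, psi *m N = 0 &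
    forall w : 'cV[K]_n.+1, psi *m w = 0 -> exists z, w = N *m z].
Proof.
case=> x0 Nx kerN.
have rN : (n <= \rank N)%N.
  have : (kermx N^T <= x^T)%MS.
    apply/row_subP => i; set r := row i _.
    have [] := kerN r^T; first by rewrite -[N]trmxK -trmx_mul -row_mul mulmx_ker row0 trmx0.
    move=> c /(congr1 trmx); rewrite trmxK => ->.
    by rewrite linearZ scalemx_sub.
  by move=> /mxrankS; rewrite mxrank_ker !mxrank_tr; have := rank_leq_col x; lia.
have : kermx N != 0.
  rewrite kermx_eq0 row_free_unit; apply: contra_neqN x0 => uN.
  by rewrite -[x](mulKmx uN) Nx mulmx0.
rewrite -nz_row_eq0; set psi := nz_row _ => psi0.
have psiN : psi *m N = 0 by apply/sub_kermxP; apply: nz_row_sub.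
exists psi; split=> // w psiw.
have sub : (N^T <= kermx psi^T)%MS by apply/sub_kermxP; rewrite -trmx_mul psiN trmx0.
have : (kermx psi^T <= N^T)%MS.
  rewrite -(geq_leqif (mxrank_leqif_sup sub)) mxrank_ker !mxrank_tr.
  by rewrite rank_rV psi0 subn1.
move=> sub'; have /submxP[z zE] : (w^T <= N^T)%MS.
  by apply: submx_trans sub'; apply/sub_kermxP; rewrite -trmx_mul psiw trmx0.
by exists z^T; apply: trmx_inj; rewrite trmx_mul trmxK.
Qed.

Lemma unit_first_col (K : fieldType) (n : nat) (x : 'cV[K]_n.+1) (x0 : x != 0) :
  exists2 P : 'M[K]_(1 + n), P \in unitmx & lsubmx P = x.
Proof.
have r1 : \rank x = 1%N.
  by apply/eqP; rewrite eqn_leq rank_leq_col lt0n mxrank_eq0.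
have := mulmx_ebase x; rewrite r1 => xE.
exists (row_ebase x 0 0 *: col_ebase x).
  rewrite unitmxZ ?col_ebase_unit //.
  have := row_ebase_unit x.
  by rewrite unitmxE det_mx11.
rewrite -[RHS]xE [X in _ *m X]mx11_scalar mul_mx_scalar linearZ /=; congr (_ *: _).
rewrite -[X in lsubmx X]mulmx1 -mulmx_lsub; congr (_ *m _).
apply/matrixP => i j; rewrite !mxE ord1 /=.
by case: i => [[|i] hi]; rewrite -val_eqE.
Qed.

(** * Deflation: quotient by a line in the source and a line in the target *)

(** The class of [v] modulo the line of the first column of [P], in the basis
    given by the other columns of [P]. *)
Definition deflatev (K : fieldType) (n : nat) (P : 'M[K]_(1 + n))
    (v : 'cV[K]_(1 + n)) : 'cV[K]_n :=
  dsubmx (invmx P *m v).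

(** When [A] maps the first column of [P] into the line of the first column of
    [Y], this is the matrix induced by [A] between the quotients by these two
    lines. *)
Definition deflate (K : fieldType) (n : nat) (Y P A : 'M[K]_(1 + n)) : 'M[K]_n :=
  drsubmx (invmx Y *m A *m P).

Lemma deflatevD (K : fieldType) n (P : 'M[K]_(1 + n)) u v :
  deflatev P (u + v) = deflatev P u + deflatev P v.
Proof. by rewrite /deflatev mulmxDr linearD. Qed.

Lemma deflatevZ (K : fieldType) n (P : 'M[K]_(1 + n)) c v :
  deflatev P (c *: v) = c *: deflatev P v.
Proof. by rewrite /deflatev -scalemxAr linearZ. Qed.

Lemma deflatev_decomp (K : fieldType) n (P : 'M[K]_(1 + n)) v : P \in unitmx ->
  exists c, v = c *: lsubmx P + rsubmx P *m deflatev P v.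
Proof.
move=> uP; exists (usubmx (invmx P *m v) 0 0).
rewrite -[LHS](mulKVmx uP) -[X in X *m _ = _]hsubmxK -[X in _ *m X = _]vsubmxK.
by rewrite mul_row_col {1}[usubmx _]mx11_scalar mul_mx_scalar.
Qed.

Lemma deflatev_lsub (K : fieldType) n (P : 'M[K]_(1 + n)) : P \in unitmx ->
  deflatev P (lsubmx P) = 0.
Proof.
move=> uP; rewrite /deflatev mulmx_lsub mulVmx //.
by rewrite scalar_mx_block block_mxEh row_mxKl col_mxKd.
Qed.

Lemma deflatev_rsub (K : fieldType) n (P : 'M[K]_(1 + n)) u : P \in unitmx ->
  deflatev P (rsubmx P *m u) = u.
Proof.
move=> uP; rewrite /deflatev mulmxA mulmx_rsub mulVmx //.
rewrite scalar_mx_block block_mxEh row_mxKr.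
by rewrite mul_col_mx col_mxKd mul1mx.
Qed.

Lemma deflatev_eq0 (K : fieldType) n (P : 'M[K]_(1 + n)) v : P \in unitmx ->
  deflatev P v = 0 -> exists c, v = c *: lsubmx P.
Proof.
by move=> uP v0; have [c] := deflatev_decomp v uP; rewrite v0 mulmx0 addr0 => ->; exists c.
Qed.

Lemma deflatev_line (K : fieldType) n (P : 'M[K]_(1 + n)) c : P \in unitmx ->
  deflatev P (c *: lsubmx P) = 0.
Proof. by move=> uP; rewrite deflatevZ deflatev_lsub // scaler0. Qed.

(** The defining property of the induced map. The hypothesis on [A] says that
    [A] is compatible with the two quotients; it is used with [c = 0] for [N]
    and with [c = 1] for the matrices of the affine space. *)
Lemma mul_deflate (K : fieldType) n (Y P A : 'M[K]_(1 + n)) c v :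
  Y \in unitmx -> P \in unitmx -> A *m lsubmx P = c *: lsubmx Y ->
  deflate Y P A *m deflatev P v = deflatev Y (A *m v).
Proof.
move=> uY uP Ax; have [d {2}->] := deflatev_decomp v uP.
rewrite mulmxDr deflatevD -scalemxAr Ax deflatevZ deflatev_line // scaler0 add0r.
by rewrite /deflate /deflatev /drsubmx -mul_dsub_mx -mulmx_rsub -mulmxA mul_dsub_mx !mulmxA.
Qed.

Lemma lsub_neq0 (K : fieldType) n (P : 'M[K]_(1 + n)) : P \in unitmx -> lsubmx P != 0.
Proof.
move=> uP; apply/eqP => P0.
have : usubmx (lsubmx (invmx P *m P)) = 0 :> 'M_1.
  by rewrite -mulmx_lsub P0 mulmx0 linear0.
rewrite mulVmx // scalar_mx_block block_mxEh row_mxKl col_mxKu => /matrixP/(_ 0 0)/eqP.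
by rewrite !mxE eqxx oner_eq0.
Qed.

(** A vector killed by [A] has a null class, so it lies on the line of the first
    column of [P], on which [A] is injective. *)
Lemma unit_of_deflate (K : fieldType) n (Y P A : 'M[K]_(1 + n)) :
  Y \in unitmx -> P \in unitmx -> A *m lsubmx P = lsubmx Y ->
  deflate Y P A \in unitmx -> A \in unitmx.
Proof.
move=> uY uP Ax uA; apply: unitmx_inj => v Av0.
have v0 : deflatev P v = 0.
  apply: (can_inj (mulKmx uA)); rewrite mulmx0 (@mul_deflate _ _ _ _ _ 1) ?scale1r //.
  by rewrite Av0 /deflatev mulmx0 linear0.
have [c vE] := deflatev_eq0 uP v0.
move: Av0; rewrite vE -scalemxAr Ax => /eqP.
by rewrite scaler_eq0 (negPf (lsub_neq0 uY)) orbF => /eqP->; rewrite scale0r.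
Qed.

Lemma deflate_is_linear (K : fieldType) n (Y P : 'M[K]_(1 + n)) :
  linear (deflate Y P).
Proof.
by move=> a A B; rewrite /deflate mulmxDr -scalemxAr mulmxDl -scalemxAl /drsubmx !linearP.
Qed.

HB.instance Definition _ (K : fieldType) n (Y P : 'M[K]_(1 + n)) :=
  GRing.isLinear.Build K 'M[K]_(1 + n) 'M[K]_n _ (deflate Y P) (deflate_is_linear Y P).

(** The class of [v] is killed by the induced map when [N v] is a multiple of
    [N x2], that is, when [v] is in the span of [x2] and [Ker N]. *)
Lemma ker_line_deflate (K : fieldType) n (Y P N : 'M[K]_(1 + n)) x2 :
  Y \in unitmx -> P \in unitmx -> ker_line N (lsubmx P) -> N *m x2 = lsubmx Y ->
  ker_line (deflate Y P N) (deflatev P x2).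
Proof.
move=> uY uP [_ Nx kerN] Nx2.
have dN v : deflate Y P N *m deflatev P v = deflatev Y (N *m v).
  by apply: (@mul_deflate _ _ _ _ _ 0) => //; rewrite scale0r.
split; first 1 last.
- by rewrite dN Nx2 deflatev_lsub.
- move=> u; rewrite -(deflatev_rsub u uP) dN; set v := _ *m _ => /(deflatev_eq0 uY)[c].
  rewrite -Nx2 scalemxAr => /eqP; rewrite -subr_eq0 -mulmxBr => /eqP/kerN[d].
  move=> /eqP; rewrite subr_eq => /eqP ->; exists c.
  by rewrite deflatevD deflatev_line // add0r deflatevZ.
apply/eqP => /(deflatev_eq0 uP)[c x2E]; have/eqP[] := lsub_neq0 uY.
by rewrite -Nx2 x2E -scalemxAr Nx scaler0.
Qed.

(** A row vanishing on the first column of [Y] factors through the quotient,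
    where its coordinates are [psi *m rsubmx Y]. *)
Lemma mul_rsub_deflatev (K : fieldType) n (Y : 'M[K]_(1 + n)) (psi : 'rV[K]_(1 + n)) w :
  Y \in unitmx -> psi *m lsubmx Y = 0 ->
  (psi *m rsubmx Y) *m deflatev Y w = psi *m w.
Proof.
move=> uY psiy; have [c {2}->] := deflatev_decomp w uY.
by rewrite mulmxDr -scalemxAr psiy scaler0 add0r mulmxA.
Qed.

(** A section of [deflate Y P], sending the first column of [P] to that of
    [Y]. *)
Definition inflate (K : fieldType) n (Y P : 'M[K]_(1 + n)) (A' : 'M[K]_n) : 'M[K]_(1 + n) :=
  Y *m block_mx 1%:M 0 0 A' *m invmx P.

Lemma inflate_lsub (K : fieldType) n (Y P : 'M[K]_(1 + n)) A' : P \in unitmx ->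
  inflate Y P A' *m lsubmx P = lsubmx Y.
Proof.
move=> uP; rewrite /inflate -mulmxA mulmx_lsub mulVmx // mulmx_lsub mulmx1.
by rewrite -mulmx_lsub block_mxEh row_mxKl -{1}[Y]hsubmxK mul_row_col mulmx1 mulmx0 addr0.
Qed.

Lemma deflateK (K : fieldType) n (Y P : 'M[K]_(1 + n)) A' :
  Y \in unitmx -> P \in unitmx -> deflate Y P (inflate Y P A') = A'.
Proof.
by move=> uY uP; rewrite /deflate /inflate !mulmxA mulVmx // mul1mx mulmxKV // block_mxKdr.
Qed.

(** Used to prescribe the value of [psi A] one size down. *)
Lemma mul_inflate (K : fieldType) n (Y P : 'M[K]_(1 + n)) A'
    (psi beta : 'rV[K]_(1 + n)) :
  Y \in unitmx -> P \in unitmx ->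
  psi *m lsubmx Y = 0 -> beta *m lsubmx P = 0 ->
  psi *m rsubmx Y *m A' = beta *m rsubmx P -> psi *m inflate Y P A' = beta.
Proof.
move=> uY uP psiy betax AE; apply: mulmx_colP => v.
rewrite -mulmxA -(mul_rsub_deflatev _ uY psiy) -(@mul_deflate _ _ _ P _ 1)
  ?scale1r ?inflate_lsub //.
by rewrite deflateK // mulmxA AE mul_rsub_deflatev.
Qed.

Lemma mul_rsub_neq0 (K : fieldType) n (Y : 'M[K]_(1 + n)) (psi : 'rV[K]_(1 + n)) :
  Y \in unitmx -> psi *m lsubmx Y = 0 -> psi != 0 -> psi *m rsubmx Y != 0.
Proof.
move=> uY psiy; apply: contraNneq => psi0; apply/eqP/mulmx_colP => w.
by rewrite -(mul_rsub_deflatev w uY psiy) psi0 !mul0mx.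
Qed.

Lemma mul_rsub_deflate (K : fieldType) n (Y P N : 'M[K]_(1 + n)) (psi : 'rV[K]_(1 + n)) :
  Y \in unitmx -> P \in unitmx -> psi *m N = 0 -> psi *m lsubmx Y = 0 ->
  N *m lsubmx P = 0 -> psi *m rsubmx Y *m deflate Y P N = 0.
Proof.
move=> uY uP psiN psiy Nx; apply: mulmx_colP => u.
rewrite -(deflatev_rsub u uP) -mulmxA (@mul_deflate _ _ _ _ _ 0) ?scale0r //.
by rewrite mul_rsub_deflatev // mulmxA psiN !mul0mx.
Qed.

Lemma deflateDZ (K : fieldType) n (Y P A N : 'M[K]_(1 + n)) l :
  deflate Y P (A + l *: N) = deflate Y P A + l *: deflate Y P N.
Proof. by rewrite linearD linearZ. Qed.

(** Since [N] kills the first column of [P], all the matrices of the pencil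
    agree on it, and each of them deflates. *)
Lemma pencil_of_deflate (K : fieldType) n (Y P A N : 'M[K]_(1 + n)) :
  Y \in unitmx -> P \in unitmx -> A *m lsubmx P = lsubmx Y -> N *m lsubmx P = 0 ->
  (forall l : K, deflate Y P A + l *: deflate Y P N \in unitmx) ->
  forall l : K, A + l *: N \in unitmx.
Proof.
move=> uY uP Ax Nx uA l; apply: (unit_of_deflate uY uP); last by rewrite deflateDZ.
by rewrite mulmxDl -scalemxAl Nx scaler0 addr0.
Qed.

(** * Completion of a prescribed border to a triangular pencil *)

(** The first two vectors [x1, x2] of a flag are prescribed, as well as the
    hyperplane [Ker beta] that is to be its last proper member, so that
    [beta x2 = 0] is necessary as soon as the size is at least [3]. Deflating
    along [x1] and [N x2] makes [x2] and a new vector [x3] the first two vectors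
    of the remaining flag; [x3] is taken in [Ker beta] whenever the flag still
    has room for it. *)
Lemma flag_completion (K : fieldType) n : forall (N : 'M[K]_n.+2) (x1 x2 : 'cV[K]_n.+2)
    (psi beta : 'rV[K]_n.+2),
  ker_line N x1 -> N *m x2 != 0 -> psi != 0 -> psi *m N = 0 ->
  beta != 0 -> beta *m x1 = 0 -> ((0 < n)%N -> beta *m x2 = 0) ->
  exists A : 'M[K]_n.+2,
    [/\ A *m x1 = N *m x2, psi *m A = beta & forall l : K, A + l *: N \in unitmx].
Proof.
elim: n => [|n IHn] N x1 x2 psi beta kN Nx20 psi0 psiN beta0 betax1 betax2;
  have [x10 Nx1 kerN] := kN;
  have [P uP Px] := unit_first_col x10; have [Y uY Yy] := unit_first_col Nx20;
  have psiy : psi *m lsubmx Y = 0 by rewrite Yy mulmxA psiN mul0mx.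
- have psi'0 := mul_rsub_neq0 uY psiy psi0.
  have betax : beta *m lsubmx P = 0 by rewrite Px.
  have beta'0 := mul_rsub_neq0 uP betax beta0.
  set psi' := psi *m rsubmx Y in psi'0; set beta' := beta *m rsubmx P in beta'0.
  pose A' : 'M[K]_1 := (beta' 0 0 / psi' 0 0)%:M.
  have N'0 : deflate Y P N = 0.
    have psiN' : psi' *m deflate Y P N = 0 by apply: mul_rsub_deflate => //; rewrite Px.
    move: psiN'; rewrite {1}[psi']mx11_scalar mul_scalar_mx => /eqP.
    by rewrite scaler_eq0 (negPf (mx11_neq0 psi'0)) /= => /eqP.
  exists (inflate Y P A'); split.
  + by rewrite -{1}Px inflate_lsub.
  + apply: mul_inflate => //; rewrite -/psi' -/beta' /A' mul_mx_scalar.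
    exact: mx11_div.
  + apply: (pencil_of_deflate uY uP); rewrite ?inflate_lsub ?Px // => l.
    rewrite N'0 scaler0 addr0 deflateK // unitmxE det_scalar1 unitfE.
    by rewrite mulf_neq0 ?invr_neq0 ?mx11_neq0.
- have {}betax2 := betax2 isT.
  have [x3 betax3 x3W] : exists2 x3 : 'cV[K]_n.+3, ((0 < n)%N -> beta *m x3 = 0) &
      x3 \notin (<[x1]> + <[x2]>)%VS.
    have dW : (\dim (<[x1]> + <[x2]>)%VS <= 2)%N.
      by rewrite (leq_trans (dimv_add_leqif _ _)) ?(leq_add (dim_vline_le _) (dim_vline_le _)).
    case: (posnP n) => [n0|n0].
      have [|x3 _ x3W] := @ker_outside K 0 n.+3 0 (<[x1]> + <[x2]>)%VS.
        by rewrite add0n (leq_ltn_trans dW).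
      by exists x3; rewrite // n0.
    have [|x3 bx3 x3W] := @ker_outside K 1 n.+3 beta (<[x1]> + <[x2]>)%VS.
      by rewrite add1n (leq_ltn_trans (n := 3)) // !ltnS.
    by exists x3.
  have kNP : ker_line N (lsubmx P) by rewrite Px.
  have NxP : N *m lsubmx P = 0 by rewrite Px.
  have k' := @ker_line_deflate _ _ Y P N x2 uY uP kNP (esym Yy).
  have dN v : deflate Y P N *m deflatev P v = deflatev Y (N *m v).
    by apply: (@mul_deflate _ _ _ _ _ 0) => //; rewrite Px scale0r.
  have betax : beta *m lsubmx P = 0 by rewrite Px.
  have [||||||A' [A'x psiA' uA']] := IHn (deflate Y P N) (deflatev P x2) (deflatev P x3)
    (psi *m rsubmx Y) (beta *m rsubmx P) k'.
  + rewrite dN; apply: contraNneq x3W => /(deflatev_eq0 uY)[c]; rewrite Yy scalemxAr.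
    move/eqP; rewrite -subr_eq0 -mulmxBr => /eqP/kerN[d /eqP].
    rewrite subr_eq => /eqP ->; apply: memv_add; apply: memvZ; exact: memv_line.
  + exact: mul_rsub_neq0.
  + exact: mul_rsub_deflate.
  + exact: mul_rsub_neq0.
  + by rewrite mul_rsub_deflatev.
  + by rewrite mul_rsub_deflatev.
  exists (inflate Y P A'); split.
  + by rewrite -{1}Px inflate_lsub.
  + by apply: mul_inflate => //.
  + by apply: (pencil_of_deflate uY uP); rewrite ?inflate_lsub ?deflateK.
Qed.

(** * Dimension counts *)

Definition eval_at (K : fieldType) n (x : 'cV[K]_n) : 'Hom('M[K]_n, 'cV[K]_n) :=
  linfun (mulmxr x).
Definition left_mul (K : fieldType) n (psi : 'rV[K]_n) : 'Hom('M[K]_n, 'rV[K]_n) :=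
  linfun (mulmx psi).

Lemma eval_atE (K : fieldType) n (x : 'cV[K]_n) A : eval_at x A = A *m x.
Proof. by rewrite lfunE. Qed.

Lemma left_mulE (K : fieldType) n (psi : 'rV[K]_n) A : left_mul psi A = psi *m A.
Proof. by rewrite lfunE. Qed.

(** Deflate along [x] in the source and along a vector [w] with [psi w <> 0] in
    the target. This is injective on the matrices considered: if the induced map
    vanishes then the image lies in the line of [w], which meets [Ker psi]
    trivially. *)
Lemma dim_mx_ker_coker (K : fieldType) n (x : 'cV[K]_n.+1) (psi : 'rV[K]_n.+1) :
  x != 0 -> psi != 0 -> (\dim (lker (eval_at x) :&: lker (left_mul psi)) <= n ^ 2)%N.
Proof.
move=> x0 psi0; have [P uP Px] := unit_first_col x0.
have [i wi] : exists i, psi 0 i != 0.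
  by apply/rV0Pn.
have psiw : (psi *m delta_mx i 0 : 'M_1) != 0.
  by apply: contraNneq wi => /matrixP/(_ 0 0); rewrite -colE !mxE => ->.
have w0 : (delta_mx i 0 : 'cV[K]_n.+1) != 0.
  by apply: contraNneq psiw => ->; rewrite mulmx0.
have [Y uY Yw] := unit_first_col w0.
rewrite -(@limg_dim_eq _ _ _ (linfun (deflate Y P))).
  by rewrite -(dim_sqmxf K) dimvS ?subvf.
apply/eqP; rewrite -subv0; apply/subvP => B.
rewrite !memv_cap !memv_ker eval_atE left_mulE lfunE /= memv0.
case/andP=> /andP[/eqP Bx /eqP psiB] /eqP fB.
apply/eqP/mulmx_colP => v; rewrite mul0mx.
have : deflatev Y (B *m v) = 0.
  by rewrite -(@mul_deflate _ _ _ P _ 0) ?fB ?mul0mx ?Px ?scale0r.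
case/(deflatev_eq0 uY) => c; rewrite Yw => BvE.
move: (congr1 (mulmx psi) BvE); rewrite mulmxA psiB mul0mx -scalemxAr => /esym/eqP.
by rewrite scaler_eq0 (negPf psiw) orbF BvE => /eqP ->; rewrite scale0r.
Qed.

(** The direction of the space of induced matrices, once the value at the first
    column of [P] has been fixed. *)
Definition deflated (K : fieldType) n (Y P : 'M[K]_(1 + n)) (V : {vspace 'M[K]_(1 + n)})
    : {vspace 'M[K]_n} :=
  (linfun (deflate Y P) @: (V :&: lker (eval_at (lsubmx P))))%VS.

(** Passing from [V] to [deflated Y P V] loses the values at the first column
    [x] of [P], then the matrices that induce [0]. The latter are the products
    [y rho], where [y] is the first column of [Y] and [rho x = 0]: they form a
    space of dimension [n], and the loss is smaller when one of them is missing
    from [V]. *)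
Lemma dim_deflated (K : fieldType) n (Y P : 'M[K]_(1 + n)) (V : {vspace 'M[K]_(1 + n)}) :
  Y \in unitmx -> P \in unitmx ->
  (\dim V <= \dim (deflated Y P V) + \dim (eval_at (lsubmx P) @: V)%VS + n)%N /\
  forall rho : 'rV[K]_(1 + n), rho *m lsubmx P = 0 -> lsubmx Y *m rho \notin V ->
  (\dim V < \dim (deflated Y P V) + \dim (eval_at (lsubmx P) @: V)%VS + n)%N.
Proof.
move=> uY uP; set x := lsubmx P; rewrite /deflated -/x.
set f := linfun _; set V0 := (V :&: _)%VS.
pose g : 'Hom('rV[K]_n, 'M[K]_(1 + n)) :=
  linfun (mulmx (lsubmx Y) \o mulmxr (dsubmx (invmx P))).
have gE (rho : 'rV[K]_(1 + n)) : rho *m x = 0 -> lsubmx Y *m rho = g (rho *m rsubmx P).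
  move=> rhox; rewrite lfunE /=; congr (_ *m _).
  rewrite -[LHS](mulmxK uP) -{1}[P]hsubmxK mul_mx_row -/x rhox.
  by rewrite -[X in _ *m X = _]vsubmxK mul_row_col mul0mx add0r.
have dimE : (\dim (V0 :&: lker f) + \dim (f @: V0) + \dim (eval_at x @: V) = \dim V)%N.
  by rewrite limg_ker_dim limg_ker_dim.
have sub : (V0 :&: lker f <= limg g)%VS.
  apply/subvP => B; rewrite !memv_cap !memv_ker eval_atE lfunE /=.
  case/andP=> /andP[_ /eqP Bx] /eqP fB.
  have BE : B = lsubmx Y *m usubmx (invmx Y *m B).
    rewrite -[LHS](mulKVmx uY) -{1}[Y]hsubmxK -{1}[invmx Y *m B]vsubmxK mul_row_col.
    rewrite [dsubmx _](_ : _ = 0) ?mulmx0 ?addr0 //; apply: mulmx_colP => v.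
    rewrite mul_dsub_mx -mulmxA -/(deflatev Y _) mul0mx.
    by rewrite -(@mul_deflate _ _ _ P _ 0) ?fB ?mul0mx ?scale0r.
  rewrite BE gE ?memv_img ?memvf //.
  by rewrite mul_usub_mx -mulmxA Bx mulmx0 linear0.
have dg : (\dim (limg g) <= n)%N.
  by rewrite -[X in (_ <= X)%N](dim_rowf K) dim_limg_le.
have arith (k b e v d m : nat) : (k + b + e = v -> k <= d -> d <= m ->
  v <= b + e + m /\ (b + e + m <= v -> d <= k))%N by lia.
have [le1 le2] := arith _ _ _ _ _ _ dimE (dimvS sub) dg.
split=> // rho rhox rhoV; have [//|/le2 le3] := ltnP.
have /eqP : (V0 :&: lker f)%VS == limg g by rewrite eqEdim sub.
move/vspaceP/(_ (lsubmx Y *m rho)); rewrite [X in _ = (X \in _)]gE // memv_img ?memvf //.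
by rewrite !memv_cap (negPf rhoV).
Qed.

(** Let [V0] be the space of matrices of [V] killing [x]. The vectors [q] such
    that [N q] is a value at [x] on [M + V] form an affine space with direction
    [U]. If the claim failed then the rows of [D = psi V0] would vanish on this
    affine space, hence on [U], so that [dim D + dim U <= s + 1]. But
    [dim U >= dim (V x)], and [dim V <= dim D + s ^ 2 + dim (V x)] by
    rank-nullity applied to [B |-> B x] and to [B |-> psi B]. *)
Lemma find_second_vector (K : fieldType) s (N M : 'M[K]_s.+1)
    (x z : 'cV[K]_s.+1) (psi : 'rV[K]_s.+1) (V : {vspace 'M[K]_s.+1}) :
  N *m x = 0 -> M *m x = N *m z -> x != 0 -> psi != 0 -> (s ^ 2 + s.+1 < \dim V)%N ->
  exists q, (exists2 C, C \in V & (M + C) *m x = N *m q) /\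
            (exists2 B, B \in V & B *m x = 0 /\ psi *m B *m q != 0).
Proof.
move=> Nx Mx x0 psi0 dV.
pose V0 := (V :&: lker (eval_at x))%VS; pose D := (left_mul psi @: V0)%VS.
pose Nl : 'Hom('cV[K]_s.+1, 'cV[K]_s.+1) := linfun (mulmx N).
pose U := (Nl @^-1: (eval_at x @: V))%VS.
have dD : (\dim V <= \dim D + s ^ 2 + \dim (eval_at x @: V)%VS)%N.
  have arith (a b c d e f : nat) : (a + b = c -> d + e = b -> d <= f -> c <= e + f + a)%N by lia.
  have e1 := limg_ker_dim (eval_at x) V.
  rewrite addnC in e1.
  apply: (arith _ _ _ _ _ _ e1 (limg_ker_dim (left_mul psi) V0)).
  by rewrite (leq_trans _ (dim_mx_ker_coker x0 psi0)) // dimvS // /V0 -capvA capvSr.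
have dU : (\dim (eval_at x @: V)%VS <= \dim U)%N.
  have imU : (Nl @: U = (eval_at x @: V) :&: limg Nl)%VS.
    by rewrite /U -lpreim_cap_limg lpreimK ?capvSr.
  have kerU : (lker Nl <= U)%VS by rewrite -lpreim0 lpreimS ?sub0v.
  have e1 := limg_ker_dim Nl U; rewrite imU (capv_idPr kerU) in e1.
  have e2 := limg_ker_dim Nl fullv; rewrite capfv dim_colf in e2.
  have e3 := dimv_sum_cap (eval_at x @: V) (limg Nl).
  have arith (k w u i m j : nat) :
    (k + w = u -> k + i = s.+1 -> m + w = j + i -> m <= s.+1 -> j <= u)%N by lia.
  exact: (arith _ _ _ _ _ _ e1 e2 e3 (dim_le_col _)).
have : exists q, (Nl q - M *m x \in eval_at x @: V)%VS /\ exists2 d, d \in D & d *m q != 0.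
  apply: NNPP => none.
  have orth q d : (Nl q - M *m x \in eval_at x @: V)%VS -> d \in D -> d *m q = 0.
    move=> qU dD'; apply/eqP/negPn/negP => dq0; apply: none.
    by exists q; split=> //; exists d.
  have zU : (Nl z - M *m x \in eval_at x @: V)%VS by rewrite lfunE /= Mx subrr mem0v.
  suff : (\dim D + \dim U <= s.+1)%N by move: dD dU dV; lia.
  apply: dim_orthogonal => d u dD' uU.
  have : d *m (z + u) = 0.
    by apply: orth => //; rewrite linearD /= addrAC memvD // memv_preim.
  by rewrite mulmxDr (orth z) // add0r.
case=> q [/memv_imgP[C CV CE] [d /memv_imgP[B]]].
rewrite memv_cap memv_ker eval_atE left_mulE => /andP[BV /eqP Bx] -> psiBq.
exists q; split; last by exists B.
exists C => //; move: CE; rewrite lfunE eval_atE /= => /eqP; rewrite subr_eq => /eqP ->.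
by rewrite mulmxDl addrC.
Qed.

(** Let [Q] be a projection with kernel the line of [x]. If [B x = 0] then
    [B = B Q], which is the sum of the products of the columns of [B], on which
    [psi] vanishes, by the rows of [Q], which vanish at [x]. If [B] is not in
    [V], neither is one of these products. *)
Lemma not_saturated (K : fieldType) n (x : 'cV[K]_n) (psi : 'rV[K]_n) (V : {vspace 'M[K]_n}) :
  x != 0 -> ~~ (lker (eval_at x) :&: lker (left_mul psi) <= V)%VS ->
  exists (w : 'cV[K]_n) (rho : 'rV[K]_n), [/\ psi *m w = 0, rho *m x = 0 & w *m rho \notin V].
Proof.
move=> x0 /subvPn[B]; rewrite memv_cap !memv_ker eval_atE left_mulE => /andP[/eqP Bx /eqP psiB] BV.
have [i xi] : exists i, x i 0 != 0 by apply/cV0Pn.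
pose rho0 : 'rV[K]_n := (x i 0)^-1 *: delta_mx 0 i.
have rho0x : rho0 *m x = 1%:M.
  by rewrite -scalemxAl -rowE [LHS]mx11_scalar !mxE mulVf.
pose Q := 1%:M - x *m rho0.
have Qx : Q *m x = 0 by rewrite mulmxBl mul1mx -mulmxA rho0x mulmx1 subrr.
have BQ : B = B *m Q by rewrite mulmxBr mulmx1 mulmxA Bx mul0mx subr0.
clearbody Q; apply: NNPP => none; case/negP: BV.
have -> : B = \sum_j col j B *m row j Q.
  rewrite {1}BQ; apply/matrixP => k l; rewrite summxE !mxE; apply: eq_bigr => j _.
  by rewrite !mxE big_ord1 !mxE.
apply: memv_suml => j _; apply/negPn/negP => wV; apply: none.
exists (col j B), (row j Q); split=> //; first by rewrite colE mulmxA psiB mul0mx.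
by rewrite -row_mul Qx row0.
Qed.

(** * Descent to a smaller size *)

Definition has_unit_line (K : fieldType) n (N M : 'M[K]_n) (V : {vspace 'M[K]_n}) :=
  exists2 A : 'M[K]_n, A - M \in V & forall l : K, A + l *: N \in unitmx.

(** Since [Ker N] is the line of [x], the condition on the images of its vectors
    is only needed at [x]. The admissible codimension is the size minus two, so
    it goes down by one at each deflation. *)
Definition unit_line_at (K : fieldType) n :=
  forall (N M : 'M[K]_n.+2) (x z : 'cV[K]_n.+2) (V : {vspace 'M[K]_n.+2}),
  ker_line N x -> M *m x = N *m z -> (n.+2 ^ 2 <= \dim V + n)%N ->
  has_unit_line N M V.

(** One step of the flag. With [s = n + 3] the size, the induced space has
    dimension at least [dim V - dim (V x) - (s - 1)], which is at least
    [dim V - 2 s + 1]: this falls short of the bound required in size [s - 1] by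
    exactly one, and each alternative of the last hypothesis supplies it. *)
Lemma descent (K : fieldType) n (IH : unit_line_at K n) (N M A : 'M[K]_n.+3)
    (x q z : 'cV[K]_n.+3) (V : {vspace 'M[K]_n.+3}) :
  ker_line N x -> A - M \in V -> A *m x = N *m q -> N *m q != 0 -> A *m q = N *m z ->
  (n.+3 ^ 2 <= \dim V + n.+1)%N ->
  [\/ (n.+3 ^ 2 <= \dim V + n)%N, (\dim (eval_at x @: V)%VS < n.+3)%N |
   exists2 rho : 'rV[K]_n.+3, rho *m x = 0 & (N *m q) *m rho \notin V] ->
  has_unit_line N M V.
Proof.
move=> kN AM Ax y0 Aq dV gain; have [x0 Nx kerN] := kN.
have [P uP Px] := unit_first_col x0; have [Y uY Yy] := unit_first_col y0.
have kNP : ker_line N (lsubmx P) by rewrite Px.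
have k' := @ker_line_deflate _ _ Y P N q uY uP kNP (esym Yy).
have dN v : deflate Y P N *m deflatev P v = deflatev Y (N *m v).
  by apply: (@mul_deflate _ _ _ _ _ 0) => //; rewrite Px scale0r.
have [] := IH (deflate Y P N) (deflate Y P A) (deflatev P q) (deflatev P z) (deflated Y P V) k'.
- by rewrite dN -Aq; apply: (@mul_deflate _ _ _ _ _ 1) => //; rewrite Px Yy Ax scale1r.
- have [le1 lt1] := dim_deflated V uY uP.
  have arith (v d e : nat) :
    ((v <= d + e + n.+2)%N -> (e <= n.+3)%N -> (n.+3 ^ 2 <= v + n.+1)%N ->
    [\/ (n.+3 ^ 2 <= v + n), (e < n.+3) | (v < d + e + n.+2)] -> (n.+2 ^ 2 <= d + n))%N.
    by move=> ? ? ? [] ?; nia.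
  apply: (arith _ _ _ le1 (dim_le_col _) dV).
  case: gain => [h|h|[rho rhox rhoV]]; [by apply: Or31|by apply: Or32; rewrite Px|].
  by apply: Or33; apply: (lt1 rho); rewrite ?Px ?Yy.
move=> A' /memv_imgP[B]; rewrite memv_cap memv_ker eval_atE Px => /andP[BV /eqP Bx].
rewrite lfunE /= => A'E uA'; exists (A + B).
  by rewrite addrAC memvD.
apply: (pencil_of_deflate uY uP); rewrite ?Px // ?mulmxDl ?Ax ?Bx ?addr0 ?Yy // => l.
by rewrite linearD /= -A'E [_ A + _]addrC subrK.
Qed.

(** * The saturated case *)

Lemma dual_basis3 (K : fieldType) (x p q : 'cV[K]_3) (a b c : 'rV[K]_3) :
  a *m x = 1%:M -> a *m p = 0 -> a *m q = 0 ->
  b *m x = 0 -> b *m p = 1%:M -> b *m q = 0 ->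
  c *m x = 0 -> c *m p = 0 -> c *m q = 1%:M ->
  forall v : 'cV[K]_3, v = x *m (a *m v) + p *m (b *m v) + q *m (c *m v).
Proof.
move=> ax ap aq bx bp bq cx cp cq v.
pose P : 'M[K]_(3, 1 + (1 + 1)) := row_mx x (row_mx p q).
pose R : 'M[K]_(1 + (1 + 1), 3) := col_mx a (col_mx b c).
have RP : R *m P = 1%:M.
  rewrite /R /P !mul_col_row ax bp cq !mul_mx_row ap aq bq !mul_col_mx bx cx cp row_mx0 col_mx0.
  by rewrite -!scalar_mx_block.
have PR : P *m R = 1%:M by apply: mulmx1C.
by rewrite -[LHS]mul1mx -PR /P /R !mul_row_col !mulmxDl !mulmxA addrA.
Qed.

(** The rows [a, b, c] are dual to the basis [x, p, q]. In the bases [x, p, q]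
    and [N p, N q, w], the pencil has rows [0, l, 1], [0, 1, 1 + l] and
    [1, 1, 0], and its determinant is [l ^ 2 + l - 1], which does not vanish at
    [0] or [1]. *)
Lemma exceptional_pencil (K : fieldType) (N : 'M[K]_3) (x p q w : 'cV[K]_3)
    (psi a b c : 'rV[K]_3) :
  (forall t : K, t = 0 \/ t = 1) ->
  ker_line N x -> psi *m N = 0 -> psi *m w = 1%:M ->
  a *m x = 1%:M -> a *m p = 0 -> a *m q = 0 ->
  b *m x = 0 -> b *m p = 1%:M -> b *m q = 0 ->
  c *m x = 0 -> c *m p = 0 -> c *m q = 1%:M ->
  forall l : K,
    N *m p *m c + N *m q *m (b + c) + w *m (a + b) + l *: N \in unitmx.
Proof.
move=> F2 [x0 Nx kerN] psiN psiw ax ap aq bx bp bq cx cp cq l.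
have res := dual_basis3 ax ap aq bx bp bq cx cp cq.
apply: unitmx_inj => v Av.
have psi_ab : (a + b) *m v = 0.
  have := congr1 (mulmx psi) Av; rewrite mulmx0 mulmxA !mulmxDr -scalemxAr !mulmxA.
  by rewrite psiN psiw !mul0mx scaler0 !mul1mx !addr0 add0r.
have : N *m (p *m (c *m v + l *: (b *m v)) + q *m (b *m v + c *m v + l *: (c *m v))) = 0.
  have Nv : N *m v = N *m (p *m (b *m v)) + N *m (q *m (c *m v)).
    by rewrite {1}(res v) !mulmxDr [N *m (x *m _)]mulmxA Nx mul0mx add0r.
  move: Av; rewrite !mulmxDl -!mulmxA psi_ab mulmx0 addr0 -scalemxAl Nv => <-.
  rewrite !mulmxDl !mulmxDr -!scalemxAr scalerDr.
  by rewrite [LHS]addrACA.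
case/kerN => d E.
have Eb := congr1 (mulmx b) E; have Ec := congr1 (mulmx c) E; move: Eb Ec.
rewrite !mulmxDr !mulmxA -!scalemxAr bx cx bp bq cp cq !mul0mx !mul1mx !scaler0 !addr0 !add0r.
move=> Eb Ec.
have [bv cv] : b *m v = 0 /\ c *m v = 0.
  case: (F2 l) Eb Ec => ->.
    by rewrite !scale0r !addr0 => ->; rewrite addr0.
  by rewrite !scale1r [c *m v + _]addrC => e; rewrite e add0r => cv; move: e; rewrite cv addr0.
by rewrite (res v) bv cv; move: psi_ab; rewrite mulmxDl bv addr0 => ->; rewrite !mulmx0 !addr0.
Qed.

(** In bases where [x] comes first in the source and [psi] is the last
    coordinate of the target, [a] and [b] are the first column and the last row
    of some matrix of [M + V]. *)
Definition has_border (K : fieldType) n (M : 'M[K]_n) (V : {vspace 'M[K]_n})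
    (x : 'cV[K]_n) (psi : 'rV[K]_n) (a : 'cV[K]_n) (b : 'rV[K]_n) :=
  exists2 A : 'M[K]_n, A - M \in V & A *m x = a /\ psi *m A = b.

Lemma has_borderD (K : fieldType) n (M : 'M[K]_n) V x psi a b a' b' :
  has_border M V x psi a b -> has_border 0 V x psi a' b' ->
  has_border M V x psi (a + a') (b + b').
Proof.
case=> A AM [<- <-] [B]; rewrite subr0 => BV [<- <-].
by exists (A + B); rewrite ?mulmxDl ?mulmxDr // addrAC memvD.
Qed.

Lemma has_borderB (K : fieldType) n (M : 'M[K]_n) V x psi a b a' b' :
  has_border M V x psi a b -> has_border M V x psi a' b' ->
  has_border 0 V x psi (a - a') (b - b').
Proof.
case=> A AM [<- <-] [B BM] [<- <-].
exists (A - B); rewrite ?mulmxBl ?mulmxBr // subr0.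
by have := memvB AM BM; rewrite opprB addrA subrK.
Qed.

Lemma has_borderZ (K : fieldType) n (V : {vspace 'M[K]_n}) x psi a b c :
  has_border 0 V x psi a b -> has_border 0 V x psi (c *: a) (c *: b).
Proof.
case=> A; rewrite subr0 => AV [<- <-].
by exists (c *: A); rewrite -?scalemxAl -?scalemxAr // subr0 memvZ.
Qed.

(** Membership in [M + V] depends only on the border, so each border that
    [flag_completion] can complete solves the problem. Suppose that none can.
    For each [v] with [delta v <> 0], the last row of a border [(N v, b)] can be
    corrected by a multiple of [delta] so as to vanish at [v], and must then be
    zero: [(N v, 0)] is a border. Two such vectors [q] and [q + p], with [p] in
    [Ker delta] outside the line of [x], give the direction [(N p, 0)]. If
    [K] has a third element [t], comparing [q] with [t q] shows that [(0, 0)] is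
    a border, so [(N p, - delta)] is one, and it can be completed. Over the
    field with two elements, let [(0, gamma)] be a border. If [gamma p = 0] then
    [(N p, gamma)] or [(N p, gamma - delta)] can be completed; such a [p] can
    always be found in size at least [4], and [exceptional_pencil] takes care of
    the remaining situation in size [3]. *)
Lemma unit_line_saturated (K : fieldType) n (N M : 'M[K]_n.+3) (x : 'cV[K]_n.+3)
    (psi delta : 'rV[K]_n.+3) (V : {vspace 'M[K]_n.+3}) :
  ker_line N x -> psi != 0 -> psi *m N = 0 ->
  (lker (eval_at x) :&: lker (left_mul psi) <= V)%VS -> (eval_at x @: V = fullv)%VS ->
  delta != 0 -> has_border 0 V x psi 0 delta ->
  has_unit_line N M V.
Proof.
move=> kN psi0 psiN QV Vx delta0 T0d; have [x0 Nx kerN] := kN.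
set T := has_border M V x psi; set TV := has_border 0 V x psi.
have sat A a b : T a b -> A *m x = a -> psi *m A = b -> A - M \in V.
  case=> B BM [Bx psiB] Ax psiA; rewrite -(subrK B A) -addrA memvD //.
  apply: (subvP QV); rewrite memv_cap !memv_ker eval_atE left_mulE.
  by rewrite mulmxBl mulmxBr Ax Bx psiA psiB !subrr !eqxx.
have Tx a b : T a b -> b *m x = psi *m a.
  by case=> A _ [<- <-]; rewrite mulmxA.
have TVx a b : TV a b -> b *m x = psi *m a.
  by case=> A _ [<- <-]; rewrite mulmxA.
have dx : delta *m x = 0 by rewrite (TVx _ _ T0d) mulmx0.
have Nneq0 v : v \notin <[x]>%VS -> N *m v != 0.
  by apply: contraNneq => /kerN[c ->]; rewrite memvZ ?memv_line.
have notinx (r : 'rV[K]_n.+3) v : r *m x = 0 -> r *m v != 0 -> v \notin <[x]>%VS.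
  move=> rx; apply: contraNN => /vlineP[c ->].
  by rewrite -scalemxAr rx scaler0.
have win q b : N *m q != 0 -> T (N *m q) b -> b != 0 -> b *m q = 0 -> has_unit_line N M V.
  move=> Nq0 Tqb b0 bq0.
  have bx : b *m x = 0 by rewrite (Tx _ _ Tqb) mulmxA psiN mul0mx.
  have [A [Ax psiA uA]] := flag_completion kN Nq0 psi0 psiN b0 bx (fun _ => bq0).
  by exists A => //; apply: (sat _ _ _ Tqb).
have fullT a : exists b, T a b.
  have : a - M *m x \in (eval_at x @: V)%VS by rewrite Vx memvf.
  case/memv_imgP=> C CV CE; exists (psi *m (M + C)), (M + C); first by rewrite addrC addKr.
  by rewrite mulmxDl -eval_atE -[X in _ + X]eval_atE -CE eval_atE addrC subrK.
have Td a b c : T a b -> T a (b - c *: delta).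
  move=> Tab; rewrite -[a]addr0 -(scaler0 _ (- c)) -scaleNr.
  by apply: has_borderD => //; apply: has_borderZ.
have TVd a b c : TV a b -> TV a (b - c *: delta).
  move=> Tab; rewrite -[a]addr0 -(scaler0 _ (- c)) -scaleNr.
  by apply: has_borderD => //; apply: has_borderZ.
(* The coefficient of [delta] is chosen so that the new row vanishes at [q]. *)
have zero_row q : delta *m q != 0 -> T (N *m q) 0 \/ has_unit_line N M V.
  move=> dq0; have [b0 Tb0] := fullT (N *m q).
  have Tb := Td _ _ ((b0 *m q) 0 0 / (delta *m q) 0 0) Tb0.
  set b := _ - _ in Tb; have bq : b *m q = 0.
    by rewrite mulmxBl -scalemxAl mx11_div // subrr.
  have [b_eq0|b_neq0] := eqVneq b 0; first by left; rewrite -b_eq0.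
  by right; apply: (win q b) => //; apply/Nneq0/(notinx delta).
have [gamma Tg] := fullT 0.
have gx : gamma *m x = 0 by rewrite (Tx _ _ Tg) mulmx0.
have [q dq1] : exists q : 'cV[K]_n.+3, delta *m q = 1%:M.
  have [i di] : exists i, delta 0 i != 0 by apply/rV0Pn.
  exists ((delta 0 i)^-1 *: delta_mx i 0).
  rewrite -scalemxAr -colE [LHS]mx11_scalar !mxE mulVf //.
have dq0 : delta *m q != 0 by rewrite dq1 oner_eq0.
(* In size 3 the only vectors of [Ker delta] killed by [gamma] may be on the
   line of [x]. *)
have [p [dp px gp]] : exists p : 'cV[K]_n.+3, [/\ delta *m p = 0, p \notin <[x]>%VS &
    (0 < n)%N -> gamma *m p = 0].
  have [n0|n0] := posnP n.
    have [|p dp px] := @ker_outside K 1 n.+3 delta <[x]>%VS;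
      last by exists p; split; rewrite // {1}n0.
    by rewrite add1n ltnS (leq_ltn_trans (dim_vline_le _)).
  have [|p] := @ker_outside K (1 + 1) n.+3 (col_mx delta gamma) <[x]>%VS.
    by rewrite -addnA (leq_ltn_trans (leq_add (leqnn _) (leq_add (leqnn _) (dim_vline_le _)))).
  rewrite mul_col_mx -[0]vsubmxK !linear0 => /eq_col_mx[dp gp] px.
  by exists p.
have Np0 := Nneq0 p px.
have [Tq|//] := zero_row q dq0.
have [Tqp|//] : T (N *m (q + p)) 0 \/ has_unit_line N M V.
  by apply: zero_row; rewrite mulmxDr dp addr0.
have TVp : TV (N *m p) 0.
  by have := has_borderB Tqp Tq; rewrite subrr -mulmxBr addrAC subrr add0r.
have [[t [t0 t1]]|F2] := classic (exists t : K, t <> 0 /\ t <> 1).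
  move/eqP in t0; move/eqP in t1.
  have [Ttq|//] : T (N *m (t *: q)) 0 \/ has_unit_line N M V.
    by apply: zero_row; rewrite -scalemxAr scaler_eq0 negb_or t0.
  have TVq : TV (N *m q) 0.
    have := has_borderZ (t - 1)^-1 (has_borderB Ttq Tq).
    rewrite subrr scaler0 -scalemxAr -{2}[N *m q]scale1r -scalerBl scalerA mulVf ?scale1r //.
    by rewrite subr_eq0.
  have T00 : T 0 0.
    have := has_borderD Tq (has_borderZ (-1) TVq).
    by rewrite scaler0 addr0 scaleN1r subrr.
  apply: (win p (- delta)) => //; last by rewrite mulNmx dp oppr0.
    have := Td _ _ 1 (has_borderD T00 TVp).
    by rewrite !add0r scale1r.
  by rewrite oppr_eq0.
have {}F2 (t : K) : t = 0 \/ t = 1.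
  by apply: NNPP => /not_or_and tn; apply: F2; exists t.
have Tpg : T (N *m p) gamma by have := has_borderD Tg TVp; rewrite add0r addr0.
have [gp0|gp1] : gamma *m p = 0 \/ gamma *m p = 1%:M.
- rewrite [gamma *m p]mx11_scalar; case: (F2 ((gamma *m p) 0 0)) => ->; last by right.
  by left; rewrite raddf0.
- have [g0|g0] := eqVneq gamma 0; last exact: (win p gamma).
  apply: (win p (gamma - 1 *: delta)) => //; first exact: Td.
    by rewrite g0 sub0r scale1r oppr_eq0.
  by rewrite mulmxBl gp0 -scalemxAl dp scaler0 subrr.
(* It remains to build the dual basis of [x, p, q] out of last rows of borders:
   [b] and [a] are corrections of [gamma] and [a1], and [delta] is the third
   row. *)
have n0 : n = 0%N.
  case: posnP gp => // _ /(_ isT); rewrite gp1 => /eqP; by rewrite oner_eq0.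
subst n.
pose b := gamma - (gamma *m q) 0 0 *: delta.
have Tb : T 0 b by apply: Td.
have bx : b *m x = 0 by rewrite (Tx _ _ Tb) mulmx0.
have bp : b *m p = 1%:M by rewrite mulmxBl -scalemxAl dp scaler0 subr0.
have bq : b *m q = 0.
  by rewrite mulmxBl -scalemxAl dq1 -mul_scalar_mx mulmx1 -mx11_scalar subrr.
have TVq : TV (N *m q) (- b) by have := has_borderB Tq Tb; rewrite subr0 sub0r.
have [w1 psiw1] : exists w : 'cV[K]_3, psi *m w = 1%:M.
  have [i di] : exists i, psi 0 i != 0 by apply/rV0Pn.
  exists ((psi 0 i)^-1 *: delta_mx i 0).
  by rewrite -scalemxAr -colE [LHS]mx11_scalar !mxE mulVf.
have [a1 TVa1] : exists a1, TV w1 a1.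
  have : w1 \in (eval_at x @: V)%VS by rewrite Vx memvf.
  case/memv_imgP=> C CV CE; exists (psi *m C), C; rewrite ?subr0 //.
  by rewrite -eval_atE -CE.
have := has_borderD TVa1 (has_borderZ ((a1 *m p) 0 0) TVq).
set w := w1 + _; set a2 := a1 + _ => TVa2.
have psiw : psi *m w = 1%:M.
  by rewrite /w mulmxDr -scalemxAr mulmxA psiN mul0mx scaler0 addr0.
have a2p : a2 *m p = 0.
  rewrite /a2 mulmxDl -scalemxAl mulNmx bp scalerN -mul_scalar_mx mulmx1 -mx11_scalar.
  by rewrite subrr.
pose a := a2 - (a2 *m q) 0 0 *: delta.
have TVa : TV w a by apply: TVd.
have ax : a *m x = 1%:M by rewrite (TVx _ _ TVa).
have ap : a *m p = 0 by rewrite mulmxBl -scalemxAl dp scaler0 subr0.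
have aq : a *m q = 0.
  by rewrite mulmxBl -scalemxAl dq1 -mul_scalar_mx mulmx1 -mx11_scalar subrr.
have Tw : T w (b + a) by have := has_borderD Tb TVa; rewrite add0r.
clearbody a a2 w b.
have uA := exceptional_pencil F2 kN psiN psiw ax ap aq bx bp bq dx dp dq1.
eexists; last exact: uA.
apply: (sat _ _ _ Tw).
  by rewrite !mulmxDl -!mulmxA !mulmxDl dx bx ax !(mulmx0, addr0, add0r, mulmx1).
by rewrite !mulmxDr !mulmxA psiN psiw !mul0mx !add0r !mul1mx addrC.
Qed.

(** * Induction on the size *)

(** In size [2] the affine space is the whole matrix space. In larger sizes a
    descent is possible along any [q] with [psi B q <> 0] for which the
    dimension count improves. In the unsaturated case some product [N q1 *m rho]
    is missing from [V]; since the condition [psi B q <> 0] fails only on a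
    hyperplane, one of [q0], [q1] and [q0 + q1] is a suitable [q]. *)
Lemma unit_line_induction (K : fieldType) n : unit_line_at K n.
Proof.
elim: n => [|n IH] N M x z V kN Mx dV; have [x0 Nx kerN] := kN;
  have [psi [psi0 psiN imN]] := left_kernel kN.
  have VT : V = fullv.
    by apply/eqP; rewrite eqEdim subvf dim_sqmxf; move: dV; rewrite addn0.
  have [q _ qx] : exists2 q : 'cV[K]_2, (0 : 'M[K]_(0, 2)) *m q = 0 & q \notin <[x]>%VS.
    by apply: ker_outside; rewrite add0n ltnS dim_vline_le.
  have Nq0 : N *m q != 0.
    by apply: contraNneq qx => /kerN[c ->]; rewrite memvZ ?memv_line.
  have : kermx x != 0.
    by rewrite -mxrank_eq0 mxrank_ker -lt0n subn_gt0 ltnS rank_leq_col.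
  rewrite -nz_row_eq0; set beta := nz_row _ => beta0.
  have betax : beta *m x = 0 by apply/sub_kermxP/nz_row_sub.
  have [//|A [_ _ uA]] := flag_completion kN Nq0 psi0 psiN beta0 betax _.
  by exists A => //; rewrite VT memvf.
have [|q0 [[C CV Cx] [B BV [Bx psiBq0]]]] :=
  @find_second_vector K n.+2 N M x z psi V Nx Mx x0 psi0.
  by move: dV; nia.
have notx (q : 'cV[K]_n.+3) : psi *m B *m q != 0 -> N *m q != 0.
  apply: contra_neq => Nq; have [c ->] := kerN q Nq.
  by rewrite -scalemxAr -mulmxA Bx mulmx0 scaler0.
(* [B x = 0], so subtracting a multiple of [B] keeps the value at [x] and brings
   the image of [q] into [Im N]. *)
have go q C' : C' \in V -> (M + C') *m x = N *m q -> psi *m B *m q != 0 ->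
    [\/ (n.+3 ^ 2 <= \dim V + n)%N, (\dim (eval_at x @: V)%VS < n.+3)%N |
     exists2 rho : 'rV[K]_n.+3, rho *m x = 0 & (N *m q) *m rho \notin V] ->
    has_unit_line N M V.
  move=> C'V C'x Bq; pose A := M + C' - ((psi *m (M + C') *m q) 0 0 / (psi *m B *m q) 0 0) *: B.
  have AM : A - M \in V.
    by rewrite /A addrAC [M + C']addrC addrK memvB ?memvZ.
  have Ax : A *m x = N *m q by rewrite mulmxBl -scalemxAl Bx scaler0 subr0.
  have /imN[z' Aq] : psi *m (A *m q) = 0.
    by rewrite mulmxBl -scalemxAl mulmxBr -scalemxAr !mulmxA mx11_div // subrr.
  exact: (descent IH kN AM Ax (notx q Bq) Aq dV).
have [full|notfull] := eqVneq (\dim (eval_at x @: V)%VS) n.+3; last first.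
  by apply: (go q0 C) => //; apply: Or32; rewrite ltn_neqAle notfull dim_le_col.
have {}full : (eval_at x @: V)%VS = fullv.
  by apply/eqP; rewrite eqEdim subvf dim_colf full leqnn.
have [QV|nQV] := boolP (lker (eval_at x) :&: lker (left_mul psi) <= V)%VS.
  apply: (unit_line_saturated (delta := psi *m B) _ kN psi0 psiN QV full).
    by apply: contraNneq psiBq0 => ->; rewrite mul0mx.
  by exists B => //; rewrite subr0.
have [w [rho [/imN[q1 ->] rhox wV]]] := not_saturated x0 nQV.
have anyq q : exists2 C', C' \in V & (M + C') *m x = N *m q.
  have : N *m q - M *m x \in (eval_at x @: V)%VS by rewrite full memvf.
  case/memv_imgP=> C' C'V CE; exists C' => //.
  by rewrite mulmxDl -[X in _ + X]eval_atE -CE addrC subrK.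
have try (q : 'cV[K]_n.+3) :
    psi *m B *m q != 0 -> N *m q *m rho \notin V -> has_unit_line N M V.
  move=> Bq qV; have [C' C'V C'x] := anyq q.
  by apply: (go q C') => //; apply: Or33; exists rho.
have [q0V|] := boolP (N *m q0 *m rho \in V); last exact: try.
have [Bq1|] := eqVneq (psi *m B *m q1) 0; last by move/try; apply.
apply: (try (q0 + q1)); first by rewrite mulmxDr Bq1 addr0.
apply: contraNN wV; rewrite mulmxDr mulmxDl => sV.
by rewrite -(addKr (N *m q0 *m rho) (N *m q1 *m rho)) memvD ?memvN.
Qed.

Theorem theorem5 (K : fieldType) (n : nat) (N : 'M[K]_n)
    (S : affine_subspace 'M[K]_n)
    (rankN : (\rank N + 1 = n)%N)
    (codimS : (codim S + 2 <= n)%N)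
    (hS : exists2 M : 'M[K]_n, M \in S &
            forall x : 'cV[K]_n, in_Ker N x -> in_Im N (M *m x)) :
  exists2 A : 'M[K]_n, A \in S &
    forall l : K, A + l *: N \in unitmx.
Proof.
case: n => [|[|n]] in N S rankN codimS hS *;
  [by rewrite addn1 in rankN|by rewrite addn2 in codimS|].
have [M MS hM] := hS.
have [x kN] : exists x, ker_line N x.
  have rk : \rank (kermx N^T) = 1%N.
    by rewrite mxrank_ker mxrank_tr -[X in (X - _)%N]rankN addKn.
  pose x := (nz_row (kermx N^T))^T.
  have xT0 : x^T != 0 by rewrite trmxK nz_row_eq0 -mxrank_eq0 rk.
  exists x; split; first by rewrite -trmx_eq0.
    by apply: trmx_inj; rewrite trmx0 trmx_mul trmxK; apply/sub_kermxP/nz_row_sub.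
  move=> v Nv; have vk : (v^T <= kermx N^T)%MS by apply/sub_kermxP; rewrite -trmx_mul Nv trmx0.
  have xk : (x^T <= kermx N^T)%MS by rewrite trmxK nz_row_sub.
  have kx : (kermx N^T <= x^T)%MS.
    by rewrite -(geq_leqif (mxrank_leqif_sup xk)) rk rank_rV xT0.
  have /sub_rVP[c vc] := submx_trans vk kx.
  by exists c; apply: trmx_inj; rewrite vc linearZ.
have [_ Nx _] := kN; have [z Mx] := hM x Nx.
have [|A AM uA] := unit_line_induction (V := direction S) kN Mx.
  move: codimS; rewrite /codim.
  have : (\dim (direction S) <= n.+2 ^ 2)%N.
    by rewrite -[X in (_ <= X)%N](dim_sqmxf K) dimvS ?subvf.
  by lia.
exists A => //; rewrite unfold_in /affine_mem.
by have := memvD AM MS; rewrite addrA subrK.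
Qed.
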